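(* Let $X$ be an $n$-Hilbert space, let $a_2,\dots,a_n\in X$ be fixed, and let $X_F$ be the associated Hilbert space (see context). A sequence $\{f_i\}_{i=1}^\infty$ in $X$ is a frame associated to $(a_2,\dots,a_n)$ if and only if $T_F:\{c_i\}_{i=1}^\infty\mapsto\sum_{i=1}^\infty c_if_i$ is a well-defined mapping of $l^2(\mathbb N)$ onto $X_F$.
   Context: Let $\mathbb K=\mathbb R$ or $\mathbb C$ and $n\ge 2$. An $n$-inner product on a $\mathbb K$-linear space $X$ with $\dim X\ge n$ is a map $(x,y,x_2,\dots,x_n)\mapsto\langle x,y\,|\,x_2,\dots,x_n\rangle\in\mathbb K$ such that: (I) $\langle x_1,x_1|x_2,\dots,x_n\rangle\ge 0$, with equality iff $x_1,\dots,x_n$ are linearly dependent; (II) it is invariant under permutations of $x_2,\dots,x_n$; (III) $\langle x,y|x_2,\dots,x_n\rangle=\overline{\langle y,x|x_2,\dots,x_n\rangle}$; (IV) $\langle\alpha x,y|x_2,\dots,x_n\rangle=\alpha\langle x,y|x_2,\dots,x_n\rangle$; (V) it is additive in the first variable. The induced $n$-norm is $\|x_1,x_2,\dots,x_n\|=\sqrt{\langle x_1,x_1|x_2,\dots,x_n\rangle}$. A sequence $\{x_k\}$ converges to $x$ if $\|x_k-x,x_2,\dots,x_n\|\to0$ for all $x_2,\dots,x_n\in X$, and is Cauchy if $\|x_l-x_k,x_2,\dots,x_n\|\to0$ as $l,k\to\infty$ for all $x_2,\dots,x_n\in X$; $X$ is an $n$-Hilbert space if every Cauchy sequence converges. Fix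 linearly independent $a_2,\dots,a_n\in X$, put $F=\{a_2,\dots,a_n\}$, and let $L_F$ be the span of $F$. The form $\langle x,y\rangle_F=\langle x,y|a_2,\dots,a_n\rangle$ is a semi-inner product on $X$ that induces an inner product on $X/L_F$, $\langle x+L_F,y+L_F\rangle_F=\langle x,y\rangle_F$. Identify $X/L_F$ with an algebraic complement $M_F$ of $L_F$. $X_F$ is the Hilbert space completion of $M_F\cong X/L_F$, with norm $\|\cdot\|_F$. An element of $X$ is regarded as an element of $X_F$ via its class modulo $L_F$; in particular $\sum c_if_i$ is a series in $X_F$. A sequence $\{f_i\}_{i=1}^\infty$ in $X$ is a frame associated to $(a_2,\dots,a_n)$ for $X$ if there are constants $0<A\le B<\infty$ with $A\|f,a_2,\dots,a_n\|^2\le\sum_{i=1}^\infty|\langle f,f_i|a_2,\dots,a_n\rangle|^2\le B\|f,a_2,\dots,a_n\|^2$ for all $f\in X$ (equivalently, its image in $X_F$ is a frame for the Hilbert space $X_F$). $l^2(\mathbb N)$ is the space of square summable scalar sequences; ''well-defined'' means that the series converges in $X_F$ for every $\{c_i\}\in l^2(\mathbb N)$. *)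

(* Defs.v *)
From HB Require Import structures.
From mathcomp Require Import all_boot all_order all_algebra.
From mathcomp Require Import perm sesquilinear complex.
From mathcomp Require Import all_classical all_reals all_analysis.

Set Implicit Arguments.
Unset Strict Implicit.
Unset Printing Implicit Defensive.

Import Order.TTheory GRing.Theory Num.Theory.
Import numFieldNormedType.Exports.

Local Open Scope classical_set_scope.
Local Open Scope ring_scope.

Variant field_kind := RealScalars | ComplexScalars.

Section Scalars.
Variable R : realType.

Definition scalars (k : field_kind) : numFieldType :=
  match k with
  | RealScalars => R : numFieldType
  | ComplexScalars => (R[i])%C : numFieldType
  end.

Definition sconj (k : field_kind) : scalars k -> scalars k :=
  match k with
  | RealScalars => fun x : R => x
  | ComplexScalars => fun z : R[i]%C => (z^*)%C
  end.

Definition realpart (k : field_kind) : scalars k -> R :=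
  match k with
  | RealScalars => fun x : R => x
  | ComplexScalars => fun z : R[i]%C => complex.Re z
  end.

(* The library norm `|z| takes its (real) values in the field of scalars. *)
Definition modulus (k : field_kind) (z : scalars k) : R := realpart `|z|.

End Scalars.

Section LinearFamilies.
Variables (K : numFieldType) (X : lmodType K).

Definition lin_dep (m : nat) (v : 'I_m -> X) : Prop :=
  exists2 c : 'I_m -> K, (exists i, c i != 0) & \sum_(i < m) c i *: v i = 0.

Definition in_span (m : nat) (v : 'I_m -> X) (x : X) : Prop :=
  exists c : 'I_m -> K, x = \sum_(i < m) c i *: v i.

Definition dim_ge (m : nat) : Prop := exists v : 'I_m -> X, ~ lin_dep v.

Definition fcons (m : nat) (x : X) (v : 'I_m -> X) : 'I_m.+1 -> X :=
  fun i => oapp v x (unlift ord0 i).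

End LinearFamilies.

Section NInner.
Variables (R : realType) (k : field_kind) (n : nat).
Variable X : lmodType (scalars R k).

(* [ip x y v] is < x, y | x_2, ..., x_n >; the n - 1 vectors x_2, ..., x_n are
   the values of the family v, indexed from 0. *)
Definition n_form := X -> X -> ('I_n.-1 -> X) -> scalars R k.

Record n_inner_product (ip : n_form) : Prop := NInnerProduct {
  nip_ge0 : forall x v, 0 <= ip x x v;
  nip_eq0 : forall x v, ip x x v = 0 <-> lin_dep (fcons x v);
  nip_perm : forall x y v (s : 'S_n.-1), ip x y (v \o s) = ip x y v;
  nip_conj : forall x y v, ip x y v = sconj (ip y x v);
  nip_scale : forall c x y v, ip (c *: x) y v = c * ip x y v;
  nip_add : forall x x' y v, ip (x + x') y v = ip x y v + ip x' y v
}.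

Variable ip : n_form.

Definition n_norm (x : X) (v : 'I_n.-1 -> X) : R :=
  Num.sqrt (realpart (ip x x v)).

Definition n_cvg (u : nat -> X) (x : X) : Prop :=
  forall v, (fun j => n_norm (u j - x) v) @ \oo --> (0 : R).

Definition n_cauchy (u : nat -> X) : Prop :=
  forall v, (fun p : nat * nat => n_norm (u p.1 - u p.2) v) @ (\oo, \oo)
              --> (0 : R).

Definition n_hilbert : Prop :=
  n_inner_product ip /\ forall u, n_cauchy u -> exists x, n_cvg u x.

Definition n_frame (a : 'I_n.-1 -> X) (f : nat -> X) : Prop :=
  exists A B : R, [/\ 0 < A, A <= B &
    forall x,
      ((A * n_norm x a ^+ 2)%:E
         <= \sum_(0 <= i <oo) (modulus (ip x (f i) a) ^+ 2)%:E)%E /\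
      (\sum_(0 <= i <oo) (modulus (ip x (f i) a) ^+ 2)%:E
         <= (B * n_norm x a ^+ 2)%:E)%E].

End NInner.

Section Completion.
Variables (R : realType) (k : field_kind) (n : nat).
Variable X : lmodType (scalars R k).
Variables (ip : n_form n X) (a : 'I_n.-1 -> X).

(* (H, dot, iota) is the Hilbert space completion X_F of X / L_F: H is a Hilbert
   space for dot, and the linear map iota, having kernel L_F, induces an
   isometric embedding of (X / L_F, < , >_F) onto a dense subspace of H.  This
   determines the triple up to a unique isometric isomorphism. *)
Record hilbert_completion (H : completeNormedModType (scalars R k))
    (dot : {dot H for @sconj R k}) (iota : {linear X -> H}) : Prop :=
  HilbertCompletion {
    hc_norm : forall y : H, `|y| ^+ 2 = dot y y;
    hc_ker : forall x, iota x = 0 <-> in_span a x;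
    hc_dot : forall x y, dot (iota x) (iota y) = ip x y a;
    hc_dense : dense (range iota)
  }.

End Completion.

Section Synthesis.
Variables (R : realType) (k : field_kind).

Definition l2 : set (nat -> scalars R k) :=
  [set c | (\sum_(0 <= i <oo) (modulus (c i) ^+ 2)%:E < +oo)%E].

Variable H : completeNormedModType (scalars R k).

Definition synthesis (g : nat -> H) (c : nat -> scalars R k) : H :=
  limn (series (fun i => c i *: g i)).

Definition synthesis_well_defined (g : nat -> H) : Prop :=
  forall c, l2 c -> cvgn (series (fun i => c i *: g i)).

Definition synthesis_onto (g : nat -> H) : Prop :=
  synthesis g @` l2 = [set: H].

End Synthesis.

(* Main.v *)
Require Import Defs.
From mathcomp Require Import all_boot all_order all_algebra.
From mathcomp Require Import sesquilinear complex.
From mathcomp Require Import ring lra.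
From mathcomp Require Import all_classical all_reals all_analysis.

(** Every finite sum y = \sum c_i f_i lies in X, and |y|^2 = \sum c_i <f_i, y>,
    so Cauchy-Schwarz turns the upper frame bound into
    |\sum c_i f_i|^2 <= B \sum |c_i|^2 and back; with completeness this makes T_F
    well defined.  If moreover the lower bound A holds on the dense image of X,
    the frame operator S v = \sum <v, f_i> f_i satisfies |v - S v / B| <= q |v|
    for some q < 1, so S x = y is solved by a fixed-point iteration, and
    y = T_F(<x, f_i>).
    Conversely, if T_F were well defined but unbounded on finite sequences, then
    disjoint blocks of coefficients of geometrically decreasing norm, each
    synthesising a vector of norm at least 1, would form a square summable sequence
    whose series diverges.
    If T_F is onto, then the vectors u with \sum |<u, f_i>|^2 <= 1 are weakly
    bounded, hence bounded, which is the lower frame bound. *)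

Set Implicit Arguments.
Unset Strict Implicit.
Unset Printing Implicit Defensive.

Import Order.TTheory GRing.Theory Num.Theory.
Import numFieldNormedType.Exports.

Local Open Scope classical_set_scope.
Local Open Scope ring_scope.

(** * Real-valued modulus and norm *)

Section ScalarTheory.
Variables (R : realType) (k : field_kind).
Implicit Types (x y : scalars R k) (t s : R).

Definition real_scalar : R -> scalars R k :=
  match k with
  | RealScalars => fun t : R => t
  | ComplexScalars => fun t : R => (t%:C)%C
  end.

Lemma realpartK t : realpart (real_scalar t) = t.
Proof. by rewrite /real_scalar /realpart; case: k. Qed.

(** Nonnegativity in [R[i]] forces a zero imaginary part. Norms, which are scalars by type, can
    therefore be moved to [R], where the order is total. *)
Lemma ge0_real_scalar x : 0 <= x -> x = real_scalar (realpart x).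
Proof.
rewrite /real_scalar /realpart; case: k x => //= x.
by case: x => a b; rewrite lecE /= => /andP[/eqP -> _].
Qed.

Lemma real_scalarM : {morph real_scalar : s t / s * t}.
Proof. by rewrite /real_scalar; case: k => //= s t; rewrite rmorphM. Qed.

Lemma real_scalarD : {morph real_scalar : s t / s + t}.
Proof. by rewrite /real_scalar; case: k => //= s t; rewrite rmorphD. Qed.

Lemma ler_real_scalar : {mono real_scalar : s t / s <= t}.
Proof. by rewrite /real_scalar; case: k => //= s t; rewrite lecR. Qed.

Lemma ltr_real_scalar : {mono real_scalar : s t / s < t}.
Proof. by rewrite /real_scalar; case: k => //= s t; rewrite ltcR. Qed.

Lemma real_scalar0 : real_scalar 0 = 0.
Proof. by rewrite /real_scalar; case: k. Qed.

Lemma real_scalar1 : real_scalar 1 = 1.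
Proof. by rewrite /real_scalar; case: k. Qed.

Lemma realpartM t x : realpart (real_scalar t * x) = t * realpart x.
Proof.
rewrite /real_scalar /realpart; case: k x => //= x; case: x => a b /=.
by rewrite mul0r subr0.
Qed.

Lemma realpartD : {morph @realpart R k : x y / x + y}.
Proof. by rewrite /realpart; case: k => //= -[? ?] [? ?]. Qed.

Lemma realpart0 : realpart (0 : scalars R k) = 0.
Proof. by rewrite /realpart; case: k. Qed.

Lemma realpart_conj x : realpart (sconj x) = realpart x.
Proof. by rewrite /sconj /realpart; case: k x => //= -[]. Qed.

Lemma normE_modulus x : `|x| = real_scalar (modulus x).
Proof. exact: ge0_real_scalar. Qed.

Lemma modulus_ge0 x : 0 <= modulus x.
Proof. by rewrite -ler_real_scalar -normE_modulus real_scalar0. Qed.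

Lemma modulusM x y : modulus (x * y) = modulus x * modulus y.
Proof. by rewrite {1}/modulus normrM normE_modulus realpartM. Qed.

Lemma modulus_real t : modulus (real_scalar t) = `|t|.
Proof.
rewrite /modulus /real_scalar /realpart; case: k => //=.
by rewrite expr0n addr0 sqrtr_sqr.
Qed.

Lemma modulus0 : modulus (0 : scalars R k) = 0.
Proof. by rewrite /modulus normr0 realpart0. Qed.

Lemma modulusD x y : modulus (x + y) <= modulus x + modulus y.
Proof.
rewrite /modulus -realpartD -ler_real_scalar -!ge0_real_scalar ?addr_ge0//.
exact: ler_normD.
Qed.

Lemma modulusN x : modulus (- x) = modulus x.
Proof. by rewrite /modulus normrN. Qed.

Lemma mulr_sconj x : x * sconj x = real_scalar (modulus x ^+ 2).
Proof.
rewrite /modulus /sconj /real_scalar /realpart; case: k x => /= x.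
  by rewrite -expr2 real_normK ?num_real.
case: x => a b /=; rewrite sqr_sqrtr ?addr_ge0 ?sqr_ge0//.
by apply/eqP; rewrite eq_complex /=; apply/andP; split; apply/eqP; ring.
Qed.

Lemma modulus_conj x : modulus (sconj x) = modulus x.
Proof.
rewrite /modulus /sconj /realpart; case: k x => //= x.
by case: x => a b /=; rewrite sqrrN.
Qed.

Lemma realpart_le_modulus x : realpart x <= modulus x.
Proof.
rewrite /modulus /realpart; case: k x => /= x; first exact: ler_norm.
case: x => a b /=; rewrite (le_trans (ler_norm a))//.
by rewrite -sqrtr_sqr ler_wsqrtr// lerDl sqr_ge0.
Qed.

Lemma realpartN x : realpart (- x) = - realpart x.
Proof. by rewrite /realpart; case: k x => //= -[]. Qed.

Lemma modulus_sum (F : nat -> scalars R k) m n :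
  modulus (\sum_(m <= i < n) F i) <= \sum_(m <= i < n) modulus (F i).
Proof.
apply: (big_ind2 (fun x s => modulus x <= s)) => [|x s y t xs yt|//].
  by rewrite modulus0.
exact: le_trans (modulusD x y) (lerD xs yt).
Qed.

Section NormedModule.
Variable V : normedModType (scalars R k).
Implicit Types u v : V.

Definition real_norm v : R := realpart `|v|.

Lemma normE_real v : `|v| = real_scalar (real_norm v).
Proof. exact: ge0_real_scalar. Qed.

Lemma real_norm_ge0 v : 0 <= real_norm v.
Proof. by rewrite -ler_real_scalar -normE_real real_scalar0. Qed.

Lemma real_normD u v : real_norm (u + v) <= real_norm u + real_norm v.
Proof.
rewrite /real_norm -realpartD -ler_real_scalar -!ge0_real_scalar ?addr_ge0//.
exact: ler_normD.
Qed.

Lemma real_normN v : real_norm (- v) = real_norm v.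
Proof. by rewrite /real_norm normrN. Qed.

Lemma real_norm_dist u v : real_norm (u - v) = real_norm (v - u).
Proof. by rewrite -real_normN opprB. Qed.

Lemma real_normZ c v : real_norm (c *: v) = modulus c * real_norm v.
Proof. by rewrite /real_norm normrZ normE_modulus realpartM. Qed.

Lemma real_norm0 : real_norm (0 : V) = 0.
Proof. by rewrite /real_norm normr0 realpart0. Qed.

Lemma real_norm_eq0 v : real_norm v = 0 -> v = 0.
Proof. by move=> v0; apply/normr0_eq0; rewrite normE_real v0 real_scalar0. Qed.

Lemma ball_real_norm u v t :
  ball u (real_scalar t) v <-> real_norm (u - v) < t.
Proof. by rewrite -ball_normE /ball_/= normE_real ltr_real_scalar. Qed.

(** A positive radius in the scalar field is itself real, so balls of real radius suffice. *)
Lemma cvg_real_normP (w : nat -> V) v :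
  w @ \oo --> v <->
  forall t, 0 < t -> exists N, forall n, (N <= n)%N -> real_norm (v - w n) < t.
Proof.
split=> [/cvg_ballP wv t t0|wv].
  have [|N _ wN] := wv (real_scalar t).
    by rewrite -real_scalar0 ltr_real_scalar.
  by exists N => n /wN; rewrite ball_real_norm.
apply/cvg_ballP => e e0; rewrite (ge0_real_scalar (ltW e0)).
have [|N wN] := wv (realpart e).
  by rewrite -ltr_real_scalar real_scalar0 -(ge0_real_scalar (ltW e0)).
by exists N => // n /= /wN; rewrite ball_real_norm.
Qed.

Lemma dense_real_norm (D : set V) v t :
  dense D -> 0 < t -> exists2 u, D u & real_norm (v - u) < t.
Proof.
move=> dD t0.
have t0' : 0 < real_scalar t by rewrite -real_scalar0 ltr_real_scalar.
have [||u [vu Du]] := dD (ball v (real_scalar t)).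
- by exists v; exact: ballxx.
- exact: ball_open.
by exists u => //; apply/ball_real_norm.
Qed.

End NormedModule.

Lemma cauchy_real_norm (V : completeNormedModType (scalars R k)) (w : nat -> V) :
  (forall t, 0 < t -> exists N, forall m n, (N <= m)%N -> (N <= n)%N ->
     real_norm (w m - w n) < t) -> cvgn w.
Proof.
move=> cw; apply/cauchy_cvgP/cauchy_exP => e e0.
rewrite (ge0_real_scalar (ltW e0)).
have [|N wN] := cw (realpart e).
  by rewrite -ltr_real_scalar real_scalar0 -(ge0_real_scalar (ltW e0)).
by exists (w N), N => // n /= Nn; apply/ball_real_norm/wN.
Qed.

End ScalarTheory.

(** * Sums of squares *)

Section RealInequalities.
Variable R : realType.
Implicit Types (a b : nat -> R).

Lemma sum_mul_sqr_le a b m n :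
  (\sum_(m <= i < n) a i * b i) ^+ 2 <=
  (\sum_(m <= i < n) a i ^+ 2) * (\sum_(m <= i < n) b i ^+ 2).
Proof.
have [mn|nm] := leqP m n; last by rewrite !big_geq ?expr0n ?mul0r// ltnW.
rewrite -(subnKC mn); elim: (n - m)%N => [|p IH].
  by rewrite addn0 !big_geq// expr0n mul0r.
rewrite addnS !big_nat_recr ?leq_addr//=.
set s := \sum_(_ <= i < _) a i * b i in IH *.
set P := \sum_(_ <= i < _) a i ^+ 2 in IH *.
set Q := \sum_(_ <= i < _) b i ^+ 2 in IH *.
have P0 : 0 <= P by apply: sumr_ge0 => i _; exact: sqr_ge0.
have Q0 : 0 <= Q by apply: sumr_ge0 => i _; exact: sqr_ge0.
move: s P Q (a _) (b _) P0 Q0 IH => s P Q x y P0 Q0 IH.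
(* AM-GM for the cross term: the square of [s * (x * y)] is at most the product of [P * y ^+ 2] and
   [Q * x ^+ 2]. *)
have sxy : `|s * (x * y)| * 2 <= P * y ^+ 2 + Q * x ^+ 2.
  have Py : 0 <= P * y ^+ 2 by rewrite mulr_ge0// sqr_ge0.
  have Qx : 0 <= Q * x ^+ 2 by rewrite mulr_ge0// sqr_ge0.
  rewrite -ler_sqr ?nnegrE ?mulr_ge0 ?addr_ge0//.
  rewrite exprMn real_normK ?num_real// exprMn.
  have : s ^+ 2 * (x * y) ^+ 2 <= P * Q * (x * y) ^+ 2.
    by rewrite ler_wpM2r// sqr_ge0.
  have := sqr_ge0 (P * y ^+ 2 - Q * x ^+ 2). lra.
have := ler_norm (s * (x * y)); lra.
Qed.

(** Partial sums of nonnegative terms increase to their limit; this trades extended-real series for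
    finite real sums. *)
Lemma nneseries_leP (u : nat -> R) (M : R) : (forall i, 0 <= u i) ->
  ((\sum_(0 <= i <oo) (u i)%:E <= M%:E)%E <->
   forall n, \sum_(0 <= i < n) u i <= M).
Proof.
move=> u0; split=> [uM n|uM].
  rewrite -lee_fin -sumEFin (le_trans _ uM)//.
  by apply: nneseries_lim_ge => i _ _; rewrite lee_fin.
apply: lime_le; first by apply: is_cvg_nneseries => i _ _; rewrite lee_fin.
by apply: nearW => n; rewrite sumEFin lee_fin.
Qed.

Lemma nneseries_fin_le (u : nat -> R) : (forall i, 0 <= u i) ->
  (\sum_(0 <= i <oo) (u i)%:E < +oo)%E ->
  exists2 s, (\sum_(0 <= i <oo) (u i)%:E = s%:E)%E &
    forall n, \sum_(0 <= i < n) u i <= s.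
Proof.
move=> u0 uoo.
have : (0 <= \sum_(0 <= i <oo) (u i)%:E)%E.
  by apply: nneseries_ge0 => i _ _; rewrite lee_fin.
case E : (\sum_(0 <= i <oo) (u i)%:E)%E uoo => [s| |] // _ _.
by exists s => //; apply/nneseries_leP; rewrite // E.
Qed.

Lemma nneseries_tail_lt (u : nat -> R) (e : R) : (forall i, 0 <= u i) ->
  (\sum_(0 <= i <oo) (u i)%:E < +oo)%E -> 0 < e ->
  exists N, forall m n, (N <= m)%N -> \sum_(m <= i < n) u i < e.
Proof.
move=> u0 uoo e0; have [s Es us] := nneseries_fin_le u0 uoo.
(* Past an [N] whose partial sum exceeds [s - e], less than [e] is left; without such an [N],
   [s - e] would bound the whole series. *)
have [N sN] : exists N, s - e < \sum_(0 <= i < N) u i.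
  apply: contrapT => /forallNP sN.
  have : (\sum_(0 <= i <oo) (u i)%:E <= (s - e)%:E)%E.
    by apply/nneseries_leP => // n; rewrite leNgt; apply/negP/sN.
  by rewrite Es lee_fin; lra.
exists N => m n Nm; have [mn|nm] := leqP m n; last by rewrite big_geq// ltnW.
have := us n; rewrite (big_cat_nat (leq0n m) mn)/=.
rewrite (big_cat_nat (leq0n N) Nm)/=.
have : 0 <= \sum_(N <= i < m) u i by exact: sumr_ge0.
lra.
Qed.

Lemma expr_lt_small (q e : R) : 0 <= q < 1 -> 0 < e ->
  exists N, forall n, (N <= n)%N -> q ^+ n < e.
Proof.
move=> /andP[q0 q1] e0.
have /cvg_expr/cvgrPdist_lt/(_ e e0)[N _ qN] : `|q| < 1 by rewrite ger0_norm.
by exists N => n /qN /=; rewrite sub0r normrN ger0_norm ?exprn_ge0.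
Qed.

End RealInequalities.

(** * Passing inequalities to limits, and geometric convergence *)

Section CompleteSpace.
Variables (R : realType) (k : field_kind).
Variable V : completeNormedModType (scalars R k).

(** If [phi v] exceeded [M], a point of [D] within [(phi v - M) / (L + 1)] of [v] would contradict
    the one-sided Lipschitz estimate; [L + 1] allows for [L = 0]. *)
Lemma lipschitz_le_closure (D : set V) (phi : V -> R) (L M : R) (v : V) :
  0 <= L -> (forall u, phi v <= phi u + L * real_norm (v - u)) ->
  (forall t, 0 < t -> exists2 u, D u & real_norm (v - u) < t) ->
  (forall u, D u -> phi u <= M) -> phi v <= M.
Proof.
move=> L0 phiL clD phiM; rewrite leNgt; apply/negP => Mphi.
have L1 : 0 < L + 1 by lra.
have [|u Du uv] := clD ((phi v - M) / (L + 1)); first by rewrite divr_gt0//; lra.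
have := phiL u; have := phiM u Du.
have := real_norm_ge0 (v - u).
move: uv; rewrite ltr_pdivlMr//; nra.
Qed.

Lemma lipschitz_le_cvg (w : nat -> V) (phi : V -> R) (L M : R) (v : V) (N : nat) :
  0 <= L -> (forall u, phi v <= phi u + L * real_norm (v - u)) ->
  w @ \oo --> v ->
  (forall n, (N <= n)%N -> phi (w n) <= M) -> phi v <= M.
Proof.
move=> L0 phiL /cvg_real_normP wv phiM.
apply: (@lipschitz_le_closure [set w n | n in [set n | (N <= n)%N]] phi L) => //.
  move=> t /wv[N' vt]; exists (w (maxn N N')); last exact/vt/leq_maxr.
  by exists (maxn N N') => //=; exact: leq_maxl.
by move=> _ [n /= Nn <-]; exact: phiM.
Qed.

(** Serves both the fixed-point iteration and the uniform boundedness argument; the latter also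
    needs the explicit distance to the limit. *)
Lemma geometric_cvg (w : nat -> V) (C q : R) : 0 <= q < 1 -> 0 <= C ->
  (forall n, real_norm (w n.+1 - w n) <= C * q ^+ n) ->
  exists2 v, w @ \oo --> v &
    forall n, real_norm (v - w n) <= C * q ^+ n / (1 - q).
Proof.
move=> /andP[q0 q1] C0 wS.
have q1' : 0 < 1 - q by lra.
have wD n p : real_norm (w (n + p)%N - w n) <= C * q ^+ n / (1 - q).
  (* The exact value of the finite geometric sum makes the induction on [p] close. *)
  suff wD' : real_norm (w (n + p)%N - w n) <= C * (q ^+ n - q ^+ (n + p)) / (1 - q).
    apply: (le_trans wD'); rewrite ler_wpM2r ?invr_ge0 ?(ltW q1')// ler_wpM2l//.
    by rewrite gerBl exprn_ge0.
  elim: p => [|p IH]; first by rewrite addn0 !subrr real_norm0 mulr0 mul0r.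
  rewrite addnS -(subrK (w (n + p)%N) (w _)) -addrA.
  apply: (le_trans (real_normD _ _)); apply: (le_trans (lerD (wS _) IH)).
  rewrite exprS -[X in X + _](mulfK (lt0r_neq0 q1')) -mulrDl.
  by rewrite ler_wpM2r ?invr_ge0 ?(ltW q1')//; lra.
have wC m n : (m <= n)%N -> real_norm (w n - w m) <= C * q ^+ m / (1 - q).
  by move=> mn; rewrite -(subnKC mn).
have small t : 0 < t -> exists N, C * q ^+ N / (1 - q) < t.
  move=> t0; have [||N qN] := @expr_lt_small R q (t * (1 - q) / (C + 1)).
  - by rewrite q0.
  - by rewrite divr_gt0 ?mulr_gt0//; lra.
  exists N; rewrite ltr_pdivrMr//; move/(_ _ (leqnn N)) : qN.
  rewrite ltr_pdivlMr; last lra.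
  by have := exprn_ge0 N q0; move: (q ^+ N) => x; nra.
have : cvgn w.
  apply: cauchy_real_norm => t t0; have [|N wN] := small (t / 2); first by lra.
  exists N => m n Nm Nn; rewrite -(subrKA (w N)) (le_lt_trans (real_normD _ _))//.
  rewrite (real_norm_dist (w N)); have := wC _ _ Nm; have := wC _ _ Nn; lra.
move=> /cvg_ex[v wv]; exists v => // n.
apply: (@lipschitz_le_cvg w (fun u => real_norm (u - w n)) 1 _ v n) wv _ => //.
  by move=> u; rewrite mul1r [leRHS]addrC -(subrKA u v) real_normD.
by move=> m; exact: wC.
Qed.

End CompleteSpace.

(** * Inner products and Cauchy-Schwarz *)

Section InnerProductSpace.
Variables (R : realType) (k : field_kind).
Variable V : completeNormedModType (scalars R k).
Variable dot : {dot V for @sconj R k}.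
Hypothesis norm_dot : forall v, `|v| ^+ 2 = dot v v.
Implicit Types (u v w : V) (c : nat -> scalars R k) (g : nat -> V).

Lemma dot_conj u v : dot u v = sconj (dot v u).
Proof.
have : dot u v = (-1) ^+ false * sconj (dot v u).
  by case: dot => ? [? ? []].
by rewrite expr0 mul1r.
Qed.

Lemma realpart_dotC u v : realpart (dot u v) = realpart (dot v u).
Proof. by rewrite dot_conj realpart_conj. Qed.

Lemma dotDl u v w : dot (u + v) w = dot u w + dot v w.
Proof. exact: linearDl. Qed.

Lemma dotBl u v w : dot (u - v) w = dot u w - dot v w.
Proof. exact: linearBl. Qed.

Lemma dotZl a u v : dot (a *: u) v = a * dot u v.
Proof. exact: linearZl_LR. Qed.

Lemma dot_suml (F : nat -> V) m n v :
  dot (\sum_(m <= i < n) F i) v = \sum_(m <= i < n) dot (F i) v.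
Proof. exact: linear_sumlz. Qed.

Lemma sqr_real_norm v : real_norm v ^+ 2 = realpart (dot v v).
Proof. by rewrite -norm_dot normE_real !expr2 -real_scalarM realpartK. Qed.

Lemma real_norm_sqrD u v :
  real_norm (u + v) ^+ 2 =
  real_norm u ^+ 2 + 2 * realpart (dot u v) + real_norm v ^+ 2.
Proof.
rewrite !sqr_real_norm dotDl realpartD realpart_dotC dotDl realpartD.
by rewrite (realpart_dotC v (u + v)) dotDl realpartD (realpart_dotC v u); lra.
Qed.

Lemma real_norm_sqrB u v :
  real_norm (u - v) ^+ 2 =
  real_norm u ^+ 2 - 2 * realpart (dot u v) + real_norm v ^+ 2.
Proof. by rewrite real_norm_sqrD real_normN linearNr realpartN mulrN. Qed.

(* The triangle inequality of the norm is Cauchy-Schwarz for real parts. *)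
Lemma realpart_dot_le u v : realpart (dot u v) <= real_norm u * real_norm v.
Proof.
have := real_norm_sqrD u v.
have := real_normD u v; have := real_norm_ge0 (u + v).
have := real_norm_ge0 u; have := real_norm_ge0 v; nra.
Qed.

(** Scaling [u] by the conjugate of z = <u, v> turns the product into |z|^2, so the estimate for
    real parts gives |z|^2 <= |z| |u| |v|. *)
Lemma modulus_dot_le u v : modulus (dot u v) <= real_norm u * real_norm v.
Proof.
have [->|d0] := eqVneq (modulus (dot u v)) 0.
  by rewrite mulr_ge0// real_norm_ge0.
have {}d0 : 0 < modulus (dot u v) by rewrite lt0r d0 modulus_ge0.
have := realpart_dot_le (sconj (dot u v) *: u) v.
rewrite dotZl mulrC mulr_sconj realpartK real_normZ modulus_conj.
by rewrite expr2 -mulrA ler_pM2l.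
Qed.

End InnerProductSpace.

(** * Bessel and synthesis bounds *)

Section Frames.
Variables (R : realType) (k : field_kind).
Variable V : completeNormedModType (scalars R k).
Variable dot : {dot V for @sconj R k}.
Hypothesis norm_dot : forall v, `|v| ^+ 2 = dot v v.
Variable g : nat -> V.
Implicit Types (u v w : V) (c : nat -> scalars R k) (A B : R).

Definition synthesis_bound B := forall c n,
  real_norm (\sum_(0 <= i < n) c i *: g i) ^+ 2
    <= B * \sum_(0 <= i < n) modulus (c i) ^+ 2.

Definition bessel_bound B (D : set V) := forall v n, D v ->
  \sum_(0 <= i < n) modulus (dot v (g i)) ^+ 2 <= B * real_norm v ^+ 2.

(** Quantifying over all upper bounds [s] of the partial sums replaces the value of a possibly
    divergent series. The set [D] will be the image of X in one direction and [setT] in the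
    other. *)
Definition lower_frame_bound A (D : set V) := forall v s, D v ->
  (forall n, \sum_(0 <= i < n) modulus (dot v (g i)) ^+ 2 <= s) ->
  A * real_norm v ^+ 2 <= s.

Lemma sum_modulus_sqr_ge0 c m n : 0 <= \sum_(m <= i < n) modulus (c i) ^+ 2.
Proof. by apply: sumr_ge0 => i _; exact: sqr_ge0. Qed.

Lemma modulus_dotC u v : modulus (dot u v) = modulus (dot v u).
Proof. by rewrite dot_conj modulus_conj. Qed.

Lemma modulus_dot_sum_le c v n :
  modulus (dot (\sum_(0 <= i < n) c i *: g i) v) ^+ 2 <=
  (\sum_(0 <= i < n) modulus (c i) ^+ 2) *
  (\sum_(0 <= i < n) modulus (dot v (g i)) ^+ 2).
Proof.
apply: le_trans (sum_mul_sqr_le _ _ _ _).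
rewrite ler_sqr ?nnegrE ?modulus_ge0//; last first.
  by apply: sumr_ge0 => i _; rewrite mulr_ge0 ?modulus_ge0.
rewrite dot_suml (le_trans (modulus_sum _ _ _))//.
by apply: ler_sum => i _; rewrite dotZl modulusM (modulus_dotC v).
Qed.

(** Testing v = \sum c_i g_i against itself gives |v|^4 <= (\sum |c_i|^2) B |v|^2, and |v|^2 cancels
    unless it is zero. The Bessel bound is applied only to finite sums, hence [D]. *)
Lemma bessel_synthesis_bound B (D : set V) : 0 <= B ->
  (forall c n, D (\sum_(0 <= i < n) c i *: g i)) ->
  bessel_bound B D -> synthesis_bound B.
Proof.
move=> B0 Dg gB c n; set v := \sum_(_ <= i < _) _.
have := modulus_dot_sum_le c v n; have := gB v n (Dg c n).
have := sum_modulus_sqr_ge0 c 0 n; rewrite -/v.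
have := realpart_le_modulus (dot v v); rewrite -sqr_real_norm//.
have := sum_modulus_sqr_ge0 (fun i => dot v (g i)) 0 n.
have := sqr_ge0 (real_norm v).
move: (\sum_(0 <= i < n) modulus (c i) ^+ 2) (modulus (dot v v)) => P z.
move: (\sum_(0 <= i < n) _) (_ ^+ 2) => N r.
move=> r0 N0 rz P0 NB zPN.
have [->|rn0] := eqVneq r 0; first by rewrite mulr_ge0.
have {rn0} r0' : 0 < r by rewrite lt0r rn0.
have : r ^+ 2 <= P * (B * r).
  apply: le_trans (le_trans zPN _); last by rewrite ler_wpM2l.
  by rewrite ler_sqr ?nnegrE// (le_trans r0).
by rewrite expr2 mulrA ler_pM2r// mulrC.
Qed.

Lemma dot_frame_sum v n :
  dot (\sum_(0 <= i < n) dot v (g i) *: g i) v =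
  real_scalar k (\sum_(0 <= i < n) modulus (dot v (g i)) ^+ 2).
Proof.
rewrite dot_suml (big_morph _ (@real_scalarD R k) (@real_scalar0 R k)).
by apply: eq_bigr => i _; rewrite dotZl [dot (g i) v]dot_conj mulr_sconj.
Qed.

(** With c_i = <v, g_i> and s = \sum |c_i|^2, one has s = <\sum c_i g_i, v>; Cauchy-Schwarz and the
    synthesis bound give s^2 <= B s |v|^2. *)
Lemma synthesis_bessel_bound B : 0 <= B ->
  synthesis_bound B -> bessel_bound B setT.
Proof.
move=> B0 gB v n _.
have := gB (fun i => dot v (g i)) n.
have := realpart_dot_le norm_dot (\sum_(0 <= i < n) dot v (g i) *: g i) v.
rewrite dot_frame_sum realpartK.
have := sum_modulus_sqr_ge0 (fun i => dot v (g i)) 0 n.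
have := real_norm_ge0 v.
have := real_norm_ge0 (\sum_(0 <= i < n) dot v (g i) *: g i).
move: (real_norm (\sum_(0 <= i < n) dot v (g i) *: g i)) (real_norm v) => x y.
move: (\sum_(0 <= i < n) _) => s x0 y0 s0 sxy xBs.
have [->|sn0] := eqVneq s 0; first by rewrite mulr_ge0 ?sqr_ge0.
have {}s0 : 0 < s by rewrite lt0r sn0.
have : s ^+ 2 <= B * s * y ^+ 2.
  apply: (@le_trans _ _ ((x * y) ^+ 2)); first by rewrite ler_sqr ?nnegrE ?mulr_ge0// ltW.
  by rewrite exprMn ler_wpM2r ?sqr_ge0.
by rewrite expr2 mulrAC [leRHS]mulrC ler_pM2l.
Qed.

Lemma sum_if_tail (T : nmodType) (F : nat -> T) m n : (m <= n)%N ->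
  \sum_(0 <= i < n) (if (m <= i)%N then F i else 0) = \sum_(m <= i < n) F i.
Proof.
by move=> mn; rewrite -big_mkcond [RHS](big_nat_widenl _ 0).
Qed.

(** Replace the coefficients below [m] by zero. *)
Lemma synthesis_bound_nat B c m n : synthesis_bound B -> (m <= n)%N ->
  real_norm (\sum_(m <= i < n) c i *: g i) ^+ 2
    <= B * \sum_(m <= i < n) modulus (c i) ^+ 2.
Proof.
move=> /(_ (fun i => if (m <= i)%N then c i else 0) n) + mn.
rewrite -!(sum_if_tail _ mn).
rewrite (eq_bigr (fun i => if (m <= i)%N then c i *: g i else 0)); last first.
  by move=> i _; case: ifP; rewrite ?scale0r.
rewrite [in X in _ -> X](eq_bigr
  (fun i => modulus (if (m <= i)%N then c i else 0) ^+ 2))//.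
by move=> i _; case: ifP; rewrite ?modulus0 ?expr0n.
Qed.

Lemma synthesis_bound_well_defined B : 0 <= B ->
  synthesis_bound B -> synthesis_well_defined g.
Proof.
move=> B0 gB c cl2; apply: cauchy_real_norm => t t0.
(* Tails below [t ^+ 2 / (B + 1)] have synthesis of squared norm below [t ^+ 2], also when
   [B = 0]. *)
have [||N cN] := @nneseries_tail_lt R (fun i => modulus (c i) ^+ 2)
    (t ^+ 2 / (B + 1)) _ cl2.
- by move=> i; exact: sqr_ge0.
- by rewrite divr_gt0 ?exprn_gt0//; lra.
have wN m n : (N <= m)%N -> (m <= n)%N ->
    real_norm (series (fun i => c i *: g i) n - series (fun i => c i *: g i) m) < t.
  move=> Nm mn; rewrite sub_series_geq//.
  rewrite -ltr_sqr ?nnegrE ?real_norm_ge0 ?(ltW t0)//.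
  have := synthesis_bound_nat c gB mn; have := cN m n Nm.
  have := sum_modulus_sqr_ge0 c m n.
  rewrite ltr_pdivlMr; last lra.
  move: (real_norm _ ^+ 2) (\sum_(m <= i < n) _) (t ^+ 2) => x y z; nra.
exists N => m n Nm Nn; have [mn|/ltnW nm] := leqP m n; last exact: wN.
by rewrite real_norm_dist wN.
Qed.

End Frames.

(** * Surjectivity from the frame bounds *)

Section FrameOperator.
Variables (R : realType) (k : field_kind).
Variable V : completeNormedModType (scalars R k).
Variable dot : {dot V for @sconj R k}.
Hypothesis norm_dot : forall v, `|v| ^+ 2 = dot v v.
Variable g : nat -> V.
Implicit Types (u v w : V) (c : nat -> scalars R k) (A B : R).

Variable B : R.
Hypotheses (B0 : 0 < B) (gB : synthesis_bound g B).

Definition frame_operator v := synthesis g (fun i => dot v (g i)).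

Lemma bessel_l2 v : l2 (fun i => dot v (g i)).
Proof.
apply: (@le_lt_trans _ _ (B * real_norm v ^+ 2)%:E); last exact: ltry.
apply/nneseries_leP => [i|n]; first exact: sqr_ge0.
exact: (synthesis_bessel_bound norm_dot (ltW B0) gB).
Qed.

Lemma frame_operator_cvg v :
  series (fun i => dot v (g i) *: g i) @ \oo --> frame_operator v.
Proof. exact: (synthesis_bound_well_defined (ltW B0) gB (bessel_l2 v)). Qed.

Lemma frame_operatorB u v :
  frame_operator (u - v) = frame_operator u - frame_operator v.
Proof.
apply: cvg_lim => //.
have -> : series (fun i => dot (u - v) (g i) *: g i) =
    series (fun i => dot u (g i) *: g i) - series (fun i => dot v (g i) *: g i).
  apply/funext => n; rewrite /series/= -[RHS]sumrB.
  by apply: eq_bigr => i _; rewrite dotBl scalerBl.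
exact: cvgB (@frame_operator_cvg u) (@frame_operator_cvg v).
Qed.

Lemma real_norm_frame_sum v n :
  real_norm (series (fun i => dot v (g i) *: g i) n) <= B * real_norm v.
Proof.
rewrite -ler_sqr ?nnegrE ?mulr_ge0 ?real_norm_ge0 ?(ltW B0)//.
rewrite (le_trans (gB _ n))// exprMn expr2 -mulrA ler_wpM2l ?(ltW B0)//.
exact: (synthesis_bessel_bound norm_dot (ltW B0) gB).
Qed.

Lemma real_norm_frame_operator v :
  real_norm (frame_operator v) <= B * real_norm v.
Proof.
apply: (@lipschitz_le_cvg R k V _ (@real_norm R k V) 1 _ _ 0%N)
  (@frame_operator_cvg v) _ => //.
  by move=> u; rewrite mul1r -[X in real_norm X](subrKC u) real_normD.
by move=> n _; exact: real_norm_frame_sum.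
Qed.

Definition frame_residual v := v - real_scalar k B^-1 *: frame_operator v.

Lemma frame_residualB u v :
  frame_residual (u - v) = frame_residual u - frame_residual v.
Proof.
by rewrite /frame_residual frame_operatorB scalerBr !opprD !opprK addrACA.
Qed.

(** A crude constant, which only supplies the continuity needed to extend the contraction from [D]
    by density. *)
Lemma real_norm_frame_residual v :
  real_norm (frame_residual v) <= 2 * real_norm v.
Proof.
rewrite (le_trans (real_normD _ _))// real_normN real_normZ modulus_real.
rewrite ger0_norm ?invr_ge0 ?(ltW B0)// mulrC.
have := real_norm_frame_operator v.
rewrite -ler_pdivrMl// => ?; rewrite mulrC; lra.
Qed.

Section Contraction.
Variables (A : R) (D : set V).
Hypotheses (A0 : 0 < A) (AB : A <= B) (gA : lower_frame_bound dot g A D).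
(** The factor uses A / 2 in place of A because A / 2 |v|^2 is reached by finitely many terms of the
    frame sum. *)
Local Notation q := (Num.sqrt (1 - A / (2 * B))).

Lemma frame_residual_lt1 : 0 <= q < 1.
Proof.
by rewrite sqrtr_ge0/= -[ltRHS]sqrtr1 ltr_sqrt// gtrBl divr_gt0// mulr_gt0.
Qed.

(** If no partial sum exceeded A / 2 |v|^2, this number would be an admissible [s] in the lower
    bound, forcing A <= A / 2 for nonzero v. Later partial sums only grow. *)
Lemma frame_sum_large v : D v -> exists N, forall n, (N <= n)%N ->
  A / 2 * real_norm v ^+ 2 <= \sum_(0 <= i < n) modulus (dot v (g i)) ^+ 2.
Proof.
move=> Dv; have [v0|v0] := eqVneq (real_norm v ^+ 2) 0.
  by exists 0%N => n _; rewrite v0 mulr0 sum_modulus_sqr_ge0.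
have {}v0 : 0 < real_norm v ^+ 2 by rewrite lt0r v0 sqr_ge0.
apply: contrapT => /forallNP NN.
have := gA Dv (s := A / 2 * real_norm v ^+ 2).
suff sN n : \sum_(0 <= i < n) modulus (dot v (g i)) ^+ 2 <= A / 2 * real_norm v ^+ 2.
  by move=> /(_ sN); have := mulr_gt0 A0 v0; lra.
rewrite leNgt; apply/negP => nlt; apply: (NN n) => m nm.
rewrite (le_trans (ltW nlt))// (big_cat_nat (leq0n n) nm)/= lerDl.
exact: sum_modulus_sqr_ge0.
Qed.

(* For the partial sums S_n of S, |S_n v|^2 <= B <S_n v, v>, hence
   |v - S_n v / B|^2 <= |v|^2 - <S_n v, v> / B, and <S_n v, v> is eventually at
   least A / 2 |v|^2. *)
Lemma frame_residual_contraction_on v : D v ->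
  real_norm (frame_residual v) <= q * real_norm v.
Proof.
move=> Dv; have [N large] := frame_sum_large Dv.
pose phi u := real_norm (v - real_scalar k B^-1 *: u).
apply: (@lipschitz_le_cvg R k V _ phi `|B^-1| _ _ N) (@frame_operator_cvg v) _ => //.
  move=> u; rewrite /phi -(modulus_real k) -real_normZ -real_normN.
  rewrite -(real_normN (v - _ *: u)) !opprB scalerBr -[leLHS]/(real_norm _).
  set Sv := _ *: frame_operator v; set tu := _ *: u.
  by rewrite -(subrKA tu Sv) addrC real_normD.
move=> n /large; rewrite /phi.
set Sn := series _ n => Nn.
have vSn : realpart (dot Sn v) = \sum_(0 <= i < n) modulus (dot v (g i)) ^+ 2.
  by rewrite dot_frame_sum realpartK.
have SnB : real_norm Sn ^+ 2 <= B * realpart (dot Sn v) by rewrite vSn; exact: gB.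
rewrite -vSn in Nn.
have q0 : 0 <= 1 - A / (2 * B).
  rewrite subr_ge0 ler_pdivrMr ?mulr_gt0//.
  by move: B0 AB; lra.
rewrite -ler_sqr ?nnegrE ?mulr_ge0 ?real_norm_ge0 ?sqrtr_ge0//.
rewrite exprMn sqr_sqrtr// (real_norm_sqrB norm_dot) realpart_dotC dotZl realpartM.
rewrite real_normZ exprMn modulus_real ger0_norm ?invr_ge0 ?(ltW B0)//.
have BSn : B^-1 ^+ 2 * real_norm Sn ^+ 2 <= B^-1 * realpart (dot Sn v).
  by rewrite expr2 -mulrA ler_pM2l ?invr_gt0// ler_pdivrMl.
have BNn : B^-1 * (A / 2 * real_norm v ^+ 2) <= B^-1 * realpart (dot Sn v).
  by rewrite ler_pM2l ?invr_gt0.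
rewrite invfM; lra.
Qed.

Lemma frame_residual_contraction v : dense D ->
  real_norm (frame_residual v) <= q * real_norm v.
Proof.
move=> dD; rewrite -subr_le0.
(* The Lipschitz constant 3 is 2 for the residual plus 1 for [q], which is below 1. *)
pose phi u := real_norm (frame_residual u) - q * real_norm u.
apply: (@lipschitz_le_closure R k V D phi 3) => //.
- move=> u; rewrite /phi.
  have := real_norm_frame_residual (v - u); rewrite frame_residualB.
  have := real_normD (frame_residual v - frame_residual u) (frame_residual u).
  have := real_normD (u - v) v; rewrite !subrK (real_norm_dist u).
  have /andP[] := frame_residual_lt1; have := real_norm_ge0 (v - u); nra.
- by move=> t t0; exact: dense_real_norm.
- by move=> u Du; rewrite /phi subr_le0; exact: frame_residual_contraction_on.
Qed.

Lemma frame_synthesis_onto : dense D -> synthesis_onto g.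
Proof.
move=> dD; apply/seteqP; split=> // y _.
have /andP[q0 q1] := frame_residual_lt1.
(* A fixed point of w - S w / B + y / B solves S w = y; in differences of iterates y / B cancels, so
   they contract by [q]. *)
pose next w := frame_residual w + real_scalar k B^-1 *: y.
pose w := fix w n := if n is m.+1 then next (w m) else 0.
have wS n : real_norm (w n.+1 - w n) <= real_norm (w 1%N - w 0%N) * q ^+ n.
  elim: n => [|n IH]; first by rewrite expr0 mulr1.
  have -> : w n.+2 - w n.+1 = frame_residual (w n.+1 - w n).
    by rewrite frame_residualB /= /next opprD addrACA subrr addr0.
  rewrite (le_trans (frame_residual_contraction _ dD))//.
  by rewrite exprS mulrCA ler_wpM2l.
have [||x wx _] := @geometric_cvg R k V w (real_norm (w 1%N - w 0%N)) q _ _ wS.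
- by rewrite q0.
- exact: real_norm_ge0.
(* If |x - next x| were positive, two consecutive iterates within half of it from x would give a
   contradiction: the first, after one step, is even closer to [next x]. *)
have xE : x = next x.
  apply/subr0_eq/(@real_norm_eq0 R k)/eqP; rewrite eq_le real_norm_ge0 andbT.
  apply: contrapT => /negP; rewrite -ltNge => x0.
  move/cvg_real_normP: wx => /(_ (real_norm (x - next x) / 2))[|N xN]; first lra.
  have := xN N (leqnn _); have := xN N.+1 (leqnSn _).
  have : real_norm (w N.+1 - next x) <= q * real_norm (w N - x).
    rewrite /= /next opprD addrACA subrr addr0 -frame_residualB.
    exact: frame_residual_contraction.
  rewrite (real_norm_dist (w N)).
  have := real_normD (x - w N.+1) (w N.+1 - next x); rewrite subrKA.
  by have := real_norm_ge0 (x - w N); nra.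
have Sx : frame_operator x = y.
  move: xE; rewrite /next /frame_residual -addrA -[LHS]addr0 => /addrI.
  rewrite addrC => /esym/subr0_eq /(congr1 (fun v => real_scalar k B *: v)).
  by rewrite !scalerA -real_scalarM divff ?gt_eqF// real_scalar1 !scale1r.
by exists (fun i => dot x (g i)) => //; exact: bessel_l2.
Qed.

End Contraction.

End FrameOperator.

(** * Boundedness of the synthesis map *)

Section GlidingHump.
Variables (R : realType) (k : field_kind).
Variable V : completeNormedModType (scalars R k).
Variable g : nat -> V.
Implicit Types (c : nat -> scalars R k) (B : R).

Definition tail_synthesis_bound N B := forall c n, (N <= n)%N ->
  real_norm (\sum_(N <= i < n) c i *: g i) ^+ 2
    <= B * \sum_(N <= i < n) modulus (c i) ^+ 2.

(** Triangle inequality, then Cauchy-Schwarz for the real sequences |c_i| and |g_i|; the constant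
    depends on [n]. *)
Lemma head_synthesis_bound c n :
  real_norm (\sum_(0 <= i < n) c i *: g i) ^+ 2
    <= (\sum_(0 <= i < n) real_norm (g i) ^+ 2) *
       \sum_(0 <= i < n) modulus (c i) ^+ 2.
Proof.
rewrite mulrC; apply: le_trans (sum_mul_sqr_le _ _ _ _).
rewrite ler_sqr ?nnegrE ?real_norm_ge0//; last first.
  by apply: sumr_ge0 => i _; rewrite mulr_ge0 ?modulus_ge0 ?real_norm_ge0.
apply: (big_ind2 (fun u s => real_norm u <= s)) => [|u s v t us vt|i _].
- by rewrite real_norm0.
- exact: le_trans (real_normD u v) (lerD us vt).
- by rewrite real_normZ.
Qed.

(** Finitely many vectors never cause unboundedness, so an unbounded synthesis stays unbounded
    beyond every [N]. *)
Lemma synthesis_bound_of_tail N B : 0 <= B -> tail_synthesis_bound N B ->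
  exists2 B', 0 <= B' & synthesis_bound g B'.
Proof.
move=> B0 gB; pose G n : R := \sum_(0 <= i < n) real_norm (g i) ^+ 2.
have G0 m n : 0 <= \sum_(m <= i < n) real_norm (g i) ^+ 2.
  by apply: sumr_ge0 => i _; exact: sqr_ge0.
(* The factor 2 comes from (x + y)^2 <= 2 (x^2 + y^2), applied to the head and the tail. *)
exists (2 * (G N + B)) => [|c n]; first by rewrite mulr_ge0// addr_ge0// G0.
have P0 m p := sum_modulus_sqr_ge0 c m p.
have [nN|/ltnW Nn] := leqP n N.
  rewrite (le_trans (head_synthesis_bound c n))// ler_wpM2r//.
  rewrite /G (big_cat_nat (leq0n n) nN)/=.
  have := G0 0%N n; have := G0 n N; lra.
rewrite !(big_cat_nat (leq0n N) Nn)/=.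
have := head_synthesis_bound c N; have := gB c n Nn.
set h := \sum_(0 <= i < N) c i *: g i; set t := \sum_(N <= i < n) c i *: g i.
have := real_normD h t; have := real_norm_ge0 (h + t).
have := P0 0%N N; have := P0 N n; have := G0 0%N N; rewrite -/(G N).
move: (real_norm (h + t)) (real_norm h) (real_norm t) (G N) => z x y a.
move: (\sum_(0 <= i < N) _) (\sum_(N <= i < n) _) => P Q a0 Q0 P0' z0 zxy yQ xP.
have : z ^+ 2 <= (x + y) ^+ 2 by rewrite ler_sqr ?nnegrE// (le_trans z0).
have := sqr_ge0 (x - y).
have := mulr_ge0 a0 Q0; have := mulr_ge0 B0 P0'; nra.
Qed.

Hypothesis unbounded : forall B, 0 <= B -> ~ synthesis_bound g B.

(** Coefficients violating the tail bound with constant [B] are divided by the norm of the vector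
    they synthesise. *)
Lemma unbounded_block N B : 0 < B -> exists n c,
  \sum_(N <= i < n) modulus (c i) ^+ 2 <= B^-1 /\
  1 <= real_norm (\sum_(N <= i < n) c i *: g i).
Proof.
move=> B0.
have : ~ tail_synthesis_bound N B.
  by move=> /(synthesis_bound_of_tail (ltW B0))[B' /unbounded].
move=> /existsNP[c /existsNP[n /not_implyP[_ /negP]]]; rewrite -ltNge.
set y := real_norm _ => By.
have y0 : 0 < y.
  rewrite lt0r real_norm_ge0 andbT; apply/eqP => y0.
  by move: By; rewrite y0 expr0n/= ltNge mulr_ge0 ?(ltW B0)// sum_modulus_sqr_ge0.
exists n, (fun i => real_scalar k y^-1 * c i); split.
  under eq_bigr do rewrite modulusM modulus_real exprMn.
  rewrite -mulr_sumr ger0_norm ?invr_ge0 ?(ltW y0)// exprVn.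
  by rewrite ler_pdivrMl ?exprn_gt0// ler_pdivlMr// mulrC ltW.
under eq_bigr do rewrite -scalerA.
rewrite -scaler_sumr real_normZ modulus_real ger0_norm ?invr_ge0 ?(ltW y0)//.
by rewrite mulVf ?gt_eqF.
Qed.

Lemma unbounded_not_well_defined : ~ synthesis_well_defined g.
Proof.
(* From a starting index and a block number j, [F] yields the end of the block and its coefficients,
   of squared norm at most 2^-j. *)
have /choice[F FP] (Nj : nat * nat) : exists nc : nat * (nat -> scalars R k),
    \sum_(Nj.1 <= i < nc.1) modulus (nc.2 i) ^+ 2 <= (2 ^+ Nj.2)^-1 /\
    1 <= real_norm (\sum_(Nj.1 <= i < nc.1) nc.2 i *: g i).
  have [|n [c nc]] := @unbounded_block Nj.1 (2 ^+ Nj.2); first exact: exprn_gt0.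
  by exists (n, c).
pose Ns := fix Ns j := if j is l.+1 then (F (Ns l, l)).1 else 0%N.
pose cs j := (F (Ns j, j)).2.
have csP j : \sum_(Ns j <= i < Ns j.+1) modulus (cs j i) ^+ 2 <= (2 ^+ j)^-1 /\
    1 <= real_norm (\sum_(Ns j <= i < Ns j.+1) cs j i *: g i).
  exact: FP (Ns j, j).
(* An empty block would synthesise 0, against the lower bound 1. *)
have NsS j : (Ns j < Ns j.+1)%N.
  rewrite ltnNge; apply/negP => jj; have [_] := csP j.
  by rewrite big_geq// real_norm0 ler10.
have Ns_mono i j : (i <= j)%N -> (Ns i <= Ns j)%N.
  move=> ij; rewrite -(subnKC ij).
  by elim: (j - i)%N => [|p IH]; rewrite ?addn0// addnS (leq_trans IH)// ltnW.
have Ns_ge j : (j <= Ns j)%N by elim: j => // j /leq_ltn_trans; exact.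
have /choice[J JP] i : exists j, (Ns j <= i < Ns j.+1)%N.
  elim: i => [|i [j /andP[ji ij]]]; first by exists 0%N => /=; exact: NsS 0%N.
  have [ij'|ij'] := ltnP i.+1 (Ns j.+1).
    by exists j; rewrite ij' ltnW.
  have -> : i.+1 = Ns j.+1 by apply/eqP; rewrite eqn_leq ij ij'.
  by exists j.+1; rewrite leqnn NsS.
have JE j i : (Ns j <= i < Ns j.+1)%N -> J i = j.
  move=> /andP[ji ij]; have /andP[Ji iJ] := JP i.
  apply/eqP; rewrite eqn_leq; apply/andP; split; rewrite leqNgt; apply/negP => /Ns_mono.
    by move=> /(leq_trans ij)/leq_trans/(_ Ji); rewrite ltnn.
  by move=> /(leq_trans iJ)/leq_trans/(_ ji); rewrite ltnn.
(* [J i] is the index of the block containing [i]. *)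
pose c i := cs (J i) i.
have c_block (T : Type) (idx : T) (op : T -> T -> T) (f : nat -> scalars R k -> T) j :
    \big[op/idx]_(Ns j <= i < Ns j.+1) f i (c i) =
    \big[op/idx]_(Ns j <= i < Ns j.+1) f i (cs j i).
  by apply: eq_big_nat => i ij; rewrite /c (JE _ _ ij).
(* The right-hand side is the sum of 2^-l over l < j. *)
have c2 j : \sum_(0 <= i < Ns j) modulus (c i) ^+ 2 <= 2 * (1 - (2 ^+ j)^-1).
  elim: j => [|j IH]; first by rewrite /= big_geq// expr0 invr1 subrr mulr0.
  rewrite (big_cat_nat (leq0n (Ns j)) (ltnW (NsS j)))/=.
  rewrite -[X in (_ + X <= _)]/(\sum_(Ns j <= i < Ns j.+1) modulus (c i) ^+ 2).
  rewrite (c_block _ _ _ (fun _ z => modulus z ^+ 2)).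
  have [cj _] := csP j; rewrite exprS invfM; lra.
have cl2 : l2 c.
  apply: (@le_lt_trans _ _ 2%:E); last exact: ltry.
  apply/nneseries_leP => [i|n]; first exact: sqr_ge0.
  have := c2 n; rewrite (big_cat_nat (leq0n n) (Ns_ge n))/=.
  have := sum_modulus_sqr_ge0 c n (Ns n).
  have : 0 < (2 ^+ n)^-1 :> R by rewrite invr_gt0 exprn_gt0.
  lra.
(* The partial sums at both ends of block [N] would lie within 1/2 of the limit, yet they differ by
   a vector of norm at least 1. *)
move=> /(_ c cl2) /cvg_ex[v /cvg_real_normP /(_ (1 / 2))[|N vN]]; first lra.
have [_] := csP N; rewrite -(c_block _ _ _ (fun i z => z *: g i)).
rewrite -(sub_series_geq _ (ltnW (NsS N))) -(subrKA v) leNgt => /negP; apply.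
rewrite (le_lt_trans (real_normD _ _))// (real_norm_dist _ v).
have := vN _ (Ns_ge N); have := vN _ (leq_trans (leqnSn _) (Ns_ge N.+1)).
lra.
Qed.

End GlidingHump.

Lemma well_defined_synthesis_bound (R : realType) (k : field_kind)
    (V : completeNormedModType (scalars R k)) (g : nat -> V) :
  synthesis_well_defined g -> exists2 B, 0 <= B & synthesis_bound g B.
Proof.
move=> gw; apply: contrapT => gB; apply: unbounded_not_well_defined gw => B B0 ?.
by apply: gB; exists B.
Qed.

(** * The lower frame bound from surjectivity *)

Section LowerBound.
Variables (R : realType) (k : field_kind).
Variable V : completeNormedModType (scalars R k).
Variable dot : {dot V for @sconj R k}.
Hypothesis norm_dot : forall v, `|v| ^+ 2 = dot v v.

Lemma modulus_double (z : scalars R k) : modulus (z + z) = 2 * modulus z.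
Proof.
have -> : z + z = real_scalar k 2 * z.
  by rewrite [2](natrD _ 1 1) real_scalarD real_scalar1 mulrDl mul1r.
by rewrite modulusM modulus_real ger0_norm.
Qed.

Lemma modulus_dotZ_self t v :
  modulus (dot v (real_scalar k t *: v)) = `|t| * real_norm v ^+ 2.
Proof.
rewrite modulus_dotC dotZl modulusM modulus_real -norm_dot normE_real expr2.
by rewrite modulusM !modulus_real (ger0_norm (real_norm_ge0 v)).
Qed.

(** The values at v + h and v - h differ by 2 <u, h>, so at least one of them has modulus at least
    |<u, h>|. *)
Lemma modulus_dot_pm_ge u v h : modulus (dot u (v + h)) < modulus (dot u h) ->
  modulus (dot u h) <= modulus (dot u (v - h)).
Proof.
move=> lt_uh; have := modulusD (dot u (v + h)) (- dot u (v - h)).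
have -> : dot u (v + h) - dot u (v - h) = dot u h + dot u h.
  by rewrite linearDr linearBr opprB addrC addrA subrK.
rewrite modulusN modulus_double; lra.
Qed.

(* Uniform boundedness after Sokal: if |w_j| > 2 j 3^j + 1, add +-3^-j w_j / |w_j|
   to x_j, with the sign that keeps |<w_j, x_(j+1)>| >= 3^-j |w_j|; the later steps
   change this by at most half, so the limit l has |<w_j, l>| >= j for all j. *)
Lemma weakly_bounded_bounded (E : set V) :
  (forall v, exists C : R, forall u, E u -> modulus (dot u v) <= C) ->
  exists2 M : R, 0 < M & forall u, E u -> real_norm u <= M.
Proof.
move=> Ew; apply: contrapT => unbounded.
have /choice[w wP] (j : nat) : exists u, E u /\ 2 * j%:R * 3 ^+ j + 1 < real_norm u.
  apply: contrapT => /forallNP Ej; apply: unbounded.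
  exists (2 * j%:R * 3 ^+ j + 1) => [|u Eu].
    (* The summand 1 makes this candidate for [M] positive, even at j = 0. *)
    by rewrite ltr_wpDl// mulr_ge0 ?mulr_ge0 ?exprn_ge0.
  by rewrite leNgt; apply/negP => uj; exact: (Ej u).
have w0 j : 0 < real_norm (w j).
  by have [_] := wP j; apply: le_lt_trans;
     rewrite addr_ge0// mulr_ge0 ?mulr_ge0 ?exprn_ge0.
pose h j := real_scalar k (3^-1 ^+ j / real_norm (w j)) *: w j.
pose next j v := if modulus (dot (w j) (v + h j)) < modulus (dot (w j) (h j))
  then v - h j else v + h j.
pose x := fix x j := if j is l.+1 then next l (x l) else 0.
have e0 j : 0 <= 3^-1 ^+ j :> R by rewrite exprn_ge0// invr_ge0.
have r0 j : 0 <= 3^-1 ^+ j / real_norm (w j) by rewrite divr_ge0// ltW.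
have hw j : modulus (dot (w j) (h j)) = 3^-1 ^+ j * real_norm (w j).
  by rewrite modulus_dotZ_self ger0_norm// expr2 mulrA divfK// gt_eqF.
have hn j : real_norm (h j) = 3^-1 ^+ j.
  by rewrite real_normZ modulus_real ger0_norm// divfK// gt_eqF.
have xw j : 3^-1 ^+ j * real_norm (w j) <= modulus (dot (w j) (x j.+1)).
  rewrite -hw /= /next; case: ifPn => [/modulus_dot_pm_ge//|].
  by rewrite -leNgt.
have xS j : real_norm (x j.+1 - x j) <= 1 * 3^-1 ^+ j.
  rewrite mul1r -hn /= /next; case: ifP => _; rewrite addrAC subrr add0r //.
  by rewrite real_normN.
have [||l _ xl] := geometric_cvg _ _ xS => //.
  by rewrite invr_ge0 ler0n/= invf_lt1// ltr1n.
have [C lC] := Ew l.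
have jC j : j%:R <= C.
  have [Ewj wj] := wP j; apply: le_trans (lC _ Ewj).
  have := modulusD (dot (w j) l) (dot (w j) (x j.+1 - l)).
  rewrite -linearDr subrKC => xD.
  have := modulus_dot_le norm_dot (w j) (x j.+1 - l).
  have := xl j.+1; rewrite real_norm_dist mul1r exprS.
  have := xw j; move: xD.
  (* Half of 3^-j |w_j| is what survives the later steps; the threshold 2 j 3^j makes it at least
     j. *)
  have j3 : j%:R <= 3^-1 ^+ j * real_norm (w j) / 2.
    rewrite ler_pdivlMr// exprVn mulrC [_ * real_norm _]mulrC ler_pdivlMr ?exprn_gt0//.
    lra.
  have -> : 3^-1 * 3^-1 ^+ j / (1 - 3^-1) = 3^-1 ^+ j / 2 :> R by field.
  move=> h1 h2 h3 h4.
  have : real_norm (w j) * real_norm (x j.+1 - l) <= real_norm (w j) * (3^-1 ^+ j / 2).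
    by rewrite ler_wpM2l// ltW.
  lra.
have := jC (Num.truncn C).+1; rewrite leNgt => /negP; apply.
exact: truncnS_gt.
Qed.

(** Writing v = \sum c_i g_i gives |<u, v>|^2 <= \sum |c_i|^2 for all u with \sum |<u, g_i>|^2 <= 1.
    These u thus have norm at most some M, and homogeneity yields A = M^-2. *)
Lemma synthesis_onto_lower_bound (g : nat -> V) :
  synthesis_well_defined g -> synthesis_onto g ->
  exists2 A : R, 0 < A & lower_frame_bound dot g A setT.
Proof.
move=> gw gonto.
pose N n (u : V) := \sum_(0 <= i < n) modulus (dot u (g i)) ^+ 2.
have [v|M M0 EM] := @weakly_bounded_bounded [set u | forall n, N n u <= 1].
  have [c cl2 <-] : (synthesis g @` @l2 R k) v by rewrite gonto.
  have [i|s _ cs] := nneseries_fin_le _ cl2; first exact: sqr_ge0.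
  (* From m^2 <= s follows m <= s + 1, which avoids a square root. *)
  exists (s + 1) => u uE; rewrite modulus_dotC.
  pose phi y := modulus (dot y u).
  apply: (@lipschitz_le_cvg R k V _ phi (real_norm u) _ _ 0%N) (gw c cl2) _.
  - exact: real_norm_ge0.
  - move=> y; rewrite /phi -[X in dot X u](subrKC y) dotDl.
    rewrite (le_trans (modulusD _ _))// lerD2l mulrC.
    exact: modulus_dot_le.
  - move=> n _; have := modulus_dot_sum_le dot g c u n; rewrite /phi.
    rewrite -[dot (series _ n) u]/(dot (\sum_(0 <= i < n) c i *: g i) u).
    have := cs n; have := uE n; rewrite /N.
    have := sum_modulus_sqr_ge0 c 0 n.
    have := sum_modulus_sqr_ge0 (fun i => dot u (g i)) 0 n.
    move: (modulus _) => m; move: (\sum_(0 <= i < n) modulus (c i) ^+ 2) => P.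
    move: (\sum_(0 <= i < n) _) => Q Q0 P0 Q1 Ps mPQ.
    have ms : m ^+ 2 <= s by nra.
    have := sqr_ge0 (m - 1); nra.
exists (M ^-2) => [|v s _ Ns]; first by rewrite invr_gt0 exprn_gt0.
have s0 : 0 <= s by rewrite (le_trans _ (Ns 0%N))// big_geq.
(* The slack [e] permits division by the square root of [s + e] even if [s = 0]. *)
apply/ler_addgt0Pr => e e0.
have se : 0 < s + e by lra.
have rse : 0 < Num.sqrt (s + e) by rewrite sqrtr_gt0.
have /EM : forall n, N n (real_scalar k (Num.sqrt (s + e))^-1 *: v) <= 1.
  move=> n; rewrite /N; under eq_bigr do rewrite dotZl modulusM modulus_real exprMn.
  rewrite -mulr_sumr ger0_norm ?invr_ge0 ?(ltW rse)// exprVn sqr_sqrtr ?(ltW se)//.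
  by rewrite ler_pdivrMl// mulr1 (le_trans (Ns n))// lerDl ltW.
rewrite real_normZ modulus_real ger0_norm ?invr_ge0 ?(ltW rse)// ler_pdivrMl//.
move=> vM; rewrite ler_pdivrMl ?exprn_gt0// -(sqr_sqrtr (ltW se)) -exprMn mulrC.
by rewrite ler_sqr ?nnegrE ?real_norm_ge0 ?mulr_ge0 ?(ltW M0) ?(ltW rse).
Qed.

End LowerBound.

Theorem theorem4p5 (R : realType) (k : field_kind) (n : nat) (hn : (2 <= n)%N)
    (X : lmodType (scalars R k)) (hdim : dim_ge X n)
    (ip : n_form n X) (hX : n_hilbert ip)
    (a : 'I_n.-1 -> X) (ha : ~ lin_dep a)
    (XF : completeNormedModType (scalars R k))
    (dot : {dot XF for @sconj R k}) (iota : {linear X -> XF})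
    (hXF : hilbert_completion ip a dot iota)
    (f : nat -> X) :
  n_frame ip a f <->
    synthesis_well_defined (iota \o f) /\ synthesis_onto (iota \o f).
Proof.
have norm_dot := hc_norm hXF; have dD := hc_dense hXF.
(* Through the isometry [iota], the frame inequalities on X become inequalities on the dense set
   [range iota]. *)
have n_normE x : n_norm ip x a = real_norm (iota x).
  rewrite /n_norm -(hc_dot hXF) -sqr_real_norm// sqrtr_sqr ger0_norm//.
  exact: real_norm_ge0.
have coefE x m : \sum_(0 <= i < m) modulus (ip x (f i) a) ^+ 2 =
    \sum_(0 <= i < m) modulus (dot (iota x) ((iota \o f) i)) ^+ 2.
  by apply: eq_bigr => i _; rewrite -(hc_dot hXF).
split=> [[A [B [A0 AB fAB]]]|[gw gonto]].
  have B0 : 0 < B by exact: lt_le_trans AB.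
  have gB : synthesis_bound (iota \o f) B.
    apply: (bessel_synthesis_bound (dot := dot) (D := range iota) norm_dot (ltW B0)).
      move=> c m; exists (\sum_(0 <= i < m) c i *: f i) => //.
      by rewrite linear_sum; apply: eq_bigr => i _; rewrite linearZ.
    move=> _ m [x _ <-]; have [_] := fAB x; rewrite n_normE.
    move=> /(nneseries_leP _ (fun i => sqr_ge0 _)) /(_ m).
    by rewrite coefE.
  split; first exact: synthesis_bound_well_defined (ltW B0) gB.
  apply: (frame_synthesis_onto norm_dot B0 gB A0 AB _ dD).
  move=> _ s [x _ <-] Ns; have [+ _] := fAB x; rewrite n_normE -lee_fin.
  move=> /le_trans; apply; apply/nneseries_leP => [i|m]; first exact: sqr_ge0.
  by rewrite coefE.
have [B B0 gB] := well_defined_synthesis_bound gw.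
have [A A0 gA] := synthesis_onto_lower_bound norm_dot gw gonto.
have gBessel := synthesis_bessel_bound norm_dot B0 gB.
(* The two constants arise independently; the maximum ensures [A <= B]. *)
exists A, (Num.max A B); split=> // [|x]; first by rewrite le_max lexx.
rewrite n_normE.
have upper : (\sum_(0 <= i <oo) (modulus (ip x (f i) a) ^+ 2)%:E
    <= (B * real_norm (iota x) ^+ 2)%:E)%E.
  apply/nneseries_leP => [i|m]; first exact: sqr_ge0.
  by rewrite coefE; exact: gBessel.
split; last first.
  rewrite (le_trans upper)// lee_fin ler_wpM2r ?sqr_ge0//.
  by rewrite le_max lexx orbT.
(* The upper bound makes the series finite, so its value can serve as [s] in the lower frame
   bound. *)
have [i||s -> Ns] := @nneseries_fin_le R (fun i => modulus (ip x (f i) a) ^+ 2).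
- exact: sqr_ge0.
- exact: le_lt_trans upper (ltry _).
- by rewrite lee_fin; apply: gA => // m; have := Ns m; rewrite coefE.
Qed.
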